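(* For every constant $c_*>0$ there exists a constant $c>0$ such that the following holds. Consider the hidden submatrix problem with $P_0=\mathsf{N}(0,1)$ and $P_1=\mathsf{N}(\mu,1)$, $\mu=\mu(n)>0$, and hidden set size $k=k(n)\ge1$, where $k\le c\,\mu^{-1}n^{1/3}/\log n$. Let $T(A)=1$ if there exists $X\in\mathcal{C}_4(n)$ with $$\sum_{i\in[n]}X_{\{i\},\{i\}}\le k\quad\text{and}\quad \sum_{1\le i<j\le n}A_{ij}X_{\{i\},\{j\}}\ge c_*\,\mu k^2,$$ and $T(A)=0$ otherwise. Then $T(A)=1$ with probability tending to $1$ as $n\to\infty$, both under $H_0$ and under $H_1$. In particular the degree-$4$ Sum-of-Squares test $T$ fails to distinguish between $H_0$ and $H_1$.
   Context: Hidden submatrix problem: $A\in\mathbb{R}^{n\times n}$ is a random symmetric matrix with zero diagonal. Under $H_0$ the entries $(A_{ij})_{i<j}$ are i.i.d. with law $P_0$. Under $H_1$ there is a uniformly random subset $\mathsf{Q}\subseteq[n]$ of size $k$ and, conditionally on $\mathsf{Q}$, the entries $(A_{ij})_{i<j}$ are independent with $A_{ij}\sim P_1$ if $\{i,j\}\subseteq\mathsf{Q}$ and $A_{ij}\sim P_0$ otherwise. $\binom{[n]}{\le 2}$ is the set of subsets of $[n]=\{1,\dots,n\}$ of size at most $2$ (including $\emptyset$). $\mathcal{C}_4(n)$ is the set of symmetric real matrices $X$ indexed by $\binom{[n]}{\le 2}\times\binom{[n]}{\le 2}$ such that $X\succeq0$, all $X_{S_1,S_2}\in[0,1]$, $X_{\emptyset,\emptyset}=1$,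 and $X_{S_1,S_2}=X_{S_3,S_4}$ whenever $S_1\cup S_2=S_3\cup S_4$. *)

(* Defs.v *)
From mathcomp Require Export all_boot all_order all_algebra.
From mathcomp Require Export all_classical all_reals all_analysis.

Set Implicit Arguments.
Unset Strict Implicit.
Unset Printing Implicit Defensive.

Export Order.TTheory GRing.Theory Num.Theory.
Export numFieldNormedType.Exports.

Local Open Scope classical_set_scope.
Local Open Scope ring_scope.

Definition psd (R : realType) (I : finType) (X : I -> I -> R) : Prop :=
  (forall i j, X i j = X j i) /\
  (forall v : I -> R, 0 <= \sum_i \sum_j v i * X i j * v j).

Notation subsets_le2 n := {S : {set 'I_n} | (#|S| <= 2)%N}.

Lemma set0_le2 (n : nat) : (#|@finset.set0 'I_n| <= 2)%N.
Proof. by rewrite cards0. Qed.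

Lemma set1_le2 (n : nat) (i : 'I_n) : (#|[set i]%SET| <= 2)%N.
Proof. by rewrite cards1. Qed.

Definition emptyS (n : nat) : subsets_le2 n := exist _ finset.set0 (set0_le2 n).

Definition singleS (n : nat) (i : 'I_n) : subsets_le2 n :=
  exist _ [set i]%SET (set1_le2 i).

Definition sos4_moments (R : realType) (n : nat)
    (X : subsets_le2 n -> subsets_le2 n -> R) : Prop :=
  [/\ psd X,
      forall S1 S2, 0 <= X S1 S2 <= 1,
      X (emptyS n) (emptyS n) = 1
    & forall S1 S2 S3 S4,
        (sval S1 :|: sval S2 = sval S3 :|: sval S4)%SET ->
        X S1 S2 = X S3 S4].

(* [true] stands for the value 1 of the test, i.e. for accepting H_1. *)
Definition sos4_test (R : realType) (cstar mu : R) (k n : nat) (A : 'M[R]_n)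
    : bool :=
  `[< exists X : subsets_le2 n -> subsets_le2 n -> R,
      [/\ sos4_moments X,
          \sum_(i < n) X (singleS i) (singleS i) <= k%:R
        & cstar * mu * k%:R ^+ 2 <=
          \sum_(i < n) \sum_(j < n | (i < j)%N)
             A i j * X (singleS i) (singleS j)] >].

Definition cond_prob d (T : measurableType d) (R : realType)
    (P : probability T R) (C E : set T) : \bar R :=
  (P (E `&` C) / P C)%E.

(* Here [nu] is either a probability or a conditional probability given an
   event, which is why it is only a set function. *)
Definition mutually_independent d (T : measurableType d) (R : realType)
    (nu : set T -> \bar R) (I : finType) (D : {set I}) (X : I -> T -> R)
    : Prop :=
  forall J : {set I}, J \subset D ->
  forall B : I -> set R, (forall i, measurable (B i)) ->
    nu [set w | forall i, i \in J -> B i (X i w)] =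
    (\prod_(i in J) nu (X i @^-1` B i))%E.

Definition has_law d (T : measurableType d) (R : realType)
    (nu : set T -> \bar R) (X : T -> R)
    (L : probability (measurableTypeR R) R) : Prop :=
  forall B : set R, measurable B -> nu (X @^-1` B) = L B.

Section hidden_submatrix.
Context (R : realType) (n : nat).

Definition upper_pairs : {set 'I_n * 'I_n} :=
  [set p : 'I_n * 'I_n | (p.1 < p.2)%N]%SET.

Definition random_matrix d (T : measurableType d) (P : probability T R)
    (A : 'I_n -> 'I_n -> {RV P >-> R}) (w : T) : 'M[R]_n :=
  \matrix_(i, j) A i j w.

Definition sym_zero_diag (A : 'M[R]_n) : Prop :=
  A^T = A /\ forall i, A i i = 0.

Definition null_model (L0 : probability (measurableTypeR R) R)
    d (T : measurableType d) (P : probability T R)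
    (A : 'I_n -> 'I_n -> {RV P >-> R}) : Prop :=
  [/\ forall w, sym_zero_diag (random_matrix A w),
      mutually_independent P upper_pairs (fun p => A p.1 p.2)
    & forall i j : 'I_n, (i < j)%N -> has_law P (A i j) L0].

Definition planted_model (L0 L1 : probability (measurableTypeR R) R) (k : nat)
    d (T : measurableType d) (P : probability T R)
    (Q : T -> {set 'I_n}) (A : 'I_n -> 'I_n -> {RV P >-> R}) : Prop :=
  [/\ forall w, sym_zero_diag (random_matrix A w),
      forall q, measurable (Q @^-1` [set q]),
      forall q, P (Q @^-1` [set q]) =
                (if #|q| == k then ('C(n, k)%:R^-1)%:E else 0%E)
    & forall q : {set 'I_n}, #|q| = k ->
        let Pq := cond_prob P (Q @^-1` [set q]) in
        mutually_independent Pq upper_pairs (fun p => A p.1 p.2) /\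
        forall i j : 'I_n, (i < j)%N ->
          has_law Pq (A i j) (if (i \in q) && (j \in q) then L1 else L0)].

End hidden_submatrix.

(* The sum of the type I and type II error probabilities vanishes. *)
Definition distinguishes (R : realType)
    (d0 : nat -> measure_display) (T0 : forall n, measurableType (d0 n))
    (P0 : forall n, probability (T0 n) R)
    (A0 : forall n, 'I_n -> 'I_n -> {RV (P0 n) >-> R})
    (d1 : nat -> measure_display) (T1 : forall n, measurableType (d1 n))
    (P1 : forall n, probability (T1 n) R)
    (A1 : forall n, 'I_n -> 'I_n -> {RV (P1 n) >-> R})
    (test : forall n, 'M[R]_n -> bool) : Prop :=
  (P0 n [set w | test n (random_matrix (A0 n) w) = true] +
   P1 n [set w | test n (random_matrix (A1 n) w) = false])%E
    @[n --> \oo] --> (0 : \bar R)%E.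

(* Main.v *)
From HB Require Import structures.
Require Import Defs.
From mathcomp Require Import measurable_realfun ring lra.

(* The constraints on X see the size of the hidden set only through its mean, so
   they admit the genuine moment matrix of the random set equal to Q with
   probability k/n and empty otherwise, for an arbitrary Q depending on A. It
   passes the test as soon as the entries of A inside Q sum to at least
   c_* mu k n, which the hypothesis on k makes at
   most n^(4/3)/16.
   Such a Q exists with high probability. Choosing signs greedily,
   x_j = sgn(s_j) with s_j = sum_(i<j) A_ij x_i, gives
   sum_(i<j) A_ij x_i x_j = sum_j |s_j|, and one of {x = 1}, {x = -1} carries at
   least a quarter of sum_(i<j) A_ij + sum_j |s_j|. Given the columns before j,
   s_j is N(0, j), so |s_j| exceeds t = n^(1/3) for most j, while the total sum
   has order n. Under H_1 this applies to A minus its conditional mean given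
   the hidden set, and the nonnegative mean can only help. *)

Set Implicit Arguments.
Unset Strict Implicit.
Unset Printing Implicit Defensive.

Local Open Scope classical_set_scope.
Local Open Scope ring_scope.

(** * Independent coordinates *)

Section independence.
Context d (T : measurableType d) (R : realType) (P : probability T R).
Context (I : finType) (D : {set I}) (X : I -> T -> R).
Hypothesis mX : forall i, measurable_fun setT (X i).
Hypothesis indX : mutually_independent P D X.
Implicit Types J : {set I}.

(** A π-system generating σ(X_i : i in J). The family [B] is total, and its values outside [J] are
    ignored. *)
Definition cylinders J : set (set T) :=
  [set A | exists2 B : I -> set R, forall i, measurable (B i) &
    A = [set w | forall i, i \in J -> B i (X i w)]].

Definition adapted J (y : T -> R) : Prop :=
  measurable_fun setT (y : g_sigma_algebraType (cylinders J) -> R).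

Lemma setI_closed_cylinders J : setI_closed (cylinders J).
Proof.
move=> _ _ [B1 mB1 ->] [B2 mB2 ->]; exists (fun i => B1 i `&` B2 i).
  by move=> i; exact: measurableI.
apply/seteqP; split=> w /=.
  by move=> [h1 h2] i iJ; split; [exact: h1|exact: h2].
by move=> h; split=> i /h[].
Qed.

Lemma measurable_cylinders J : cylinders J `<=` measurable.
Proof.
move=> _ [B mB ->].
have -> : [set w | forall i, i \in J -> B i (X i w)] =
    \bigcap_(i in [set` J]) (X i @^-1` B i) by [].
apply: fin_bigcap_measurable => [|i _]; first exact: finite_finpred.
by rewrite -[X in measurable X]setTI; exact: mX.
Qed.

Lemma cylinders_setT J : cylinders J setT.
Proof. by exists (fun=> setT) => //; apply/seteqP; split. Qed.

Lemma measurable_sigma_cylinders J : <<s cylinders J >> `<=` measurable.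
Proof.
by apply: smallest_sub; [exact: sigma_algebra_measurable|
  exact: measurable_cylinders].
Qed.

(** A π-λ argument: as functions of [C], both sides are finite measures, and on cylinders over [J]
    they agree by the product formula of [indX]. *)
Lemma independent_coordinate J e (B : set R) (C : set T) :
  e \in D -> J \subset D -> e \notin J -> measurable B ->
  <<s cylinders J >> C ->
  P (X e @^-1` B `&` C) = (P (X e @^-1` B) * P C)%E.
Proof.
move=> eD JD eJ mB sC.
have mXB : measurable (X e @^-1` B).
  by rewrite -[X in measurable X]setTI; exact: mX.
have p0 : 0 <= fine (P (X e @^-1` B)) by exact: fine_ge0.
pose m1 : {measure set T -> \bar R} := mrestr P mXB.
pose m2 : {measure set T -> \bar R} := mscale (NngNum p0) P.
suff : m1 C = m2 C.
  rewrite /m1 /m2 /= /mrestr /mscale /= setIC fineK //.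
  by rewrite fin_num_measure.
apply: (g_sigma_algebra_measure_unique (cylinders J) _ (fun=> setT)) => //.
- exact: measurable_cylinders.
- by move=> _; exact: cylinders_setT.
- by apply/seteqP; split=> // w _; exists 0%N.
- exact: setI_closed_cylinders.
- move=> _ [B' mB' ->]; rewrite /m1 /m2 /= /mrestr /mscale /=.
  rewrite fineK ?fin_num_measure //.
  (* Merging the two constraints turns the intersection into a single cylinder over [e |: J]; this
     is consistent because [e] is not in [J]. *)
  pose B2 i := if i == e then B else B' i.
  have mB2 i : measurable (B2 i) by rewrite /B2; case: ifP.
  have neq i : i \in J -> (i == e) = false.
    by move=> iJ; apply: contraNF eJ => /eqP <-.
  have -> : [set w | forall i, i \in J -> B' i (X i w)] `&` X e @^-1` B =
      [set w | forall i, i \in (e |: J)%SET -> B2 i (X i w)].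
    apply/seteqP; split=> w /=.
      move=> [h1 h2] i; rewrite in_setU1 /B2; case: eqP => [->//|_ /=].
      exact: h1.
    move=> h; split=> [i iJ|].
      by have := h i; rewrite in_setU1 iJ orbT /B2 neq //; exact.
    by have := h e; rewrite setU11 /B2 eqxx; exact.
  rewrite indX //; last by rewrite finset.subUset finset.sub1set eD.
  rewrite big_setU1 //= {1}/B2 eqxx; congr (_ * _)%E.
  rewrite indX //; apply: eq_bigr => i /neq; rewrite /B2 => -> //.
- by move=> _; rewrite /m1 /= /mrestr setTI -ge0_fin_numE // fin_num_measure.
Qed.

Lemma adapted_coord J e : e \in J -> adapted J (X e).
Proof.
move=> eJ _ B mB; rewrite setTI; apply: sub_sigma_algebra.
exists (fun i => if i == e then B else setT).
  by move=> i; case: ifP.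
apply/seteqP; split=> w /=; last by move=> /(_ e eJ); rewrite eqxx.
by move=> h i _; case: eqP => // ->.
Qed.

Lemma sub_adapted J J' y : J \subset J' -> adapted J y -> adapted J' y.
Proof.
move=> JJ' my _ B mB; rewrite setTI.
have := my measurableT B mB; rewrite setTI.
apply: (smallest_sub (smallest_sigma_algebra _ _)) => _ [B' mB' ->].
apply: sub_sigma_algebra.
exists (fun i => if i \in J then B' i else setT).
  by move=> i; case: ifP.
apply/seteqP; split=> w /=.
  by move=> h i _; case: ifPn => // /h.
by move=> h i iJ; have := h i (fintype.subsetP JJ' i iJ); rewrite iJ.
Qed.

Lemma adapted_measurable J y : adapted J y -> measurable_fun setT y.
Proof.
move=> my _ B mB; rewrite setTI.
have := my measurableT B mB; rewrite setTI; exact: measurable_sigma_cylinders.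
Qed.

(** The pair [(z, X e)] has the product of the law of [z] and [L] as joint law, since they agree on
    rectangles. Tonelli then integrates the fresh coordinate first. *)
Lemma integral_independent J e (L : probability (measurableTypeR R) R)
    d' (S : measurableType d') (z : T -> S) (F : S * measurableTypeR R -> \bar R) :
  e \in D -> J \subset D -> e \notin J ->
  measurable_fun setT (z : g_sigma_algebraType (cylinders J) -> S) ->
  has_law P (X e) L -> measurable_fun [set: S * measurableTypeR R] F ->
  (forall v, 0 <= F v)%E ->
  (\int[P]_w F (z w, X e w) = \int[P]_w \int[L]_u F (z w, u))%E.
Proof.
move=> eD JD eJ az XL mF F0.
have mz : measurable_fun setT z.
  move=> _ B mB; rewrite setTI.
  have := az measurableT B mB; rewrite setTI; exact: measurable_sigma_cylinders.
pose zX w : S * measurableTypeR R := (z w, X e w).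
have mzX : measurable_fun setT zX by apply: measurable_fun_pair => //; exact: mX.
transitivity (\int[pushforward P zX]_v F v)%E.
  by rewrite ge0_integral_pushforward // => v _; rewrite lee_fin.
pose zm : {mfun T >-> S} := HB.pack z (isMeasurableFun.Build _ _ _ _ _ mz).
pose Pz : probability S R := distribution P zm.
transitivity (\int[(Pz \x L)%E]_v F v)%E.
  apply: eq_measure_integral => A mA _.
  apply/esym; apply: product_measure_unique => // B C mB mC.
  rewrite /= /pushforward.
  have -> : zX @^-1` (B `*` C) = X e @^-1` C `&` z @^-1` B.
    by apply/seteqP; split=> w /= [].
  rewrite (@independent_coordinate J) //; last first.
    by have := az measurableT B mB; rewrite setTI.
  by rewrite muleC XL.
rewrite fubini_tonelli1 //.
rewrite /fubini_F /= ge0_integral_pushforward //.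
- by apply: measurable_fun_fubini_tonelli_F.
- by move=> v _; apply: integral_ge0 => u _.
Qed.

End independence.

(** * Gaussian integrals of signed sums *)

Section normal_integral.
Context (R : realType).
Local Notation leb := (@lebesgue_measure R).

(** The Radon-Nikodym derivative agrees almost everywhere with [normal_pdf], because both have the
    same integral over every measurable set. *)
Lemma ge0_integral_normal_prob (m s : R) (f : R -> \bar R) :
  measurable_fun setT f -> (forall x, 0 <= f x)%E ->
  (\int[normal_prob m s]_x f x =
   \int[leb]_x (f x * (normal_pdf m s x)%:E))%E.
Proof.
move=> mf f0; have dom := normal_prob_dominates m s.
rewrite -(Radon_Nikodym_SigmaFinite.change_of_variables dom) //.
apply: ae_eq_integral => //.
- apply: emeasurable_funM => //; apply: (measurable_int leb).
  exact: Radon_Nikodym_SigmaFinite.f_integrable.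
- apply: emeasurable_funM => //; apply/measurable_EFinP.
  exact: measurable_normal_pdf.
apply: ae_eqe_mul2l; apply: integral_ae_eq => //.
- exact: Radon_Nikodym_SigmaFinite.f_integrable.
- by apply/measurable_EFinP; exact: measurable_normal_pdf.
- by move=> E _ mE; rewrite -Radon_Nikodym_SigmaFinite.f_integral.
Qed.

Lemma normal_peakM (s : R) : 0 < s -> normal_peak 1 = s * normal_peak s.
Proof.
move=> s0; rewrite /normal_peak expr1n mul1r -mulrnAr sqrtrM ?sqr_ge0 //.
by rewrite sqrtr_sqr gtr0_norm // invfM mulrA divff ?mul1r // gt_eqF.
Qed.

(** The integrand is [K] times an unnormalized density of N(m', s^2), and the ratio of the
    normalizing constants contributes the factor [s]. A Gaussian integral is thereby reduced to
    completing a square. *)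
Lemma integral_normal_prob_proportional (m m' s K : R) (f : R -> R) :
  0 < s -> measurable_fun setT f -> (forall u, 0 <= f u) ->
  (forall u, f u * normal_fun m 1 u = K * normal_fun m' s u) ->
  (\int[normal_prob m 1]_u (f u)%:E = (K * s)%:E)%E.
Proof.
move=> s0 mf f0 fE; rewrite ge0_integral_normal_prob //; last exact/measurable_EFinP.
have K0 : 0 <= K.
  have := f0 m'; rewrite -(pmulr_lge0 _ (expR_gt0 (- (m' - m) ^+ 2 / (1 ^+ 2 *+ 2)))).
  by rewrite -/(normal_fun m 1 m') fE pmulr_lge0 // expR_gt0.
transitivity (\int[leb]_u ((K * s)%:E * (normal_pdf m' s u)%:E))%E.
  apply: eq_integral => u _; rewrite -!EFinM; congr (_%:E).
  rewrite !normal_pdfE ?oner_neq0 ?gt_eqF // mulrCA fE (normal_peakM s0); ring.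
rewrite ge0_integralZl //.
- by rewrite integral_normal_pdf mule1.
- by apply/measurable_EFinP; exact: measurable_normal_pdf.
- by move=> u _; rewrite lee_fin normal_pdf_ge0.
- by rewrite lee_fin mulr_ge0 // ltW.
Qed.

(** Completing the square: the tilted density is normal with mean m - x a y / (1 + a) and variance 1
    / (1 + a). *)
Lemma integral_normal_expR_sqr (m a y x : R) : 0 <= a -> x ^+ 2 = 1 ->
  (\int[normal_prob m 1]_u (expR (- (a * (y + x * (u - m)) ^+ 2 / 2)))%:E =
   ((Num.sqrt (1 + a))^-1 * expR (- (a / (1 + a) * y ^+ 2 / 2)))%:E)%E.
Proof.
move=> a0 x2; have a1 : 0 < 1 + a by lra.
have sq0 : 0 < Num.sqrt (1 + a) by rewrite sqrtr_gt0.
rewrite mulrC.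
apply: (@integral_normal_prob_proportional m (m - x * a * y / (1 + a))).
- by rewrite invr_gt0.
- apply: measurableT_comp => //; apply: measurableT_comp => //.
  apply: measurable_funM => //; apply: measurable_funM => //.
  apply: measurable_funX; apply: measurable_funD => //.
  by apply: measurable_funM => //; apply: measurable_funB.
- by move=> u; exact: expR_ge0.
move=> u; rewrite /normal_fun -!expRD; congr expR.
rewrite exprVn sqr_sqrtr ?ltW // expr1n.
have -> : (u - (m - x * a * y / (1 + a))) ^+ 2 =
   (u - m) ^+ 2 + 2 * x * (u - m) * a * y / (1 + a)
    + x ^+ 2 * (a * y / (1 + a)) ^+ 2 by field; lra.
have -> : (y + x * (u - m)) ^+ 2 =
   y ^+ 2 + 2 * x * (u - m) * y + x ^+ 2 * (u - m) ^+ 2 by ring.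
by rewrite x2; field; lra.
Qed.

(** Here the tilt only moves the mean, to m - t x. *)
Lemma integral_normal_expR (m t y x : R) : x ^+ 2 = 1 ->
  (\int[normal_prob m 1]_u (expR (- (t * (y + x * (u - m)))))%:E =
   (expR (t ^+ 2 / 2 - t * y))%:E)%E.
Proof.
move=> x2; rewrite -[expR (t ^+ 2 / 2 - _)]mulr1.
apply: (@integral_normal_prob_proportional m (m - t * x)) => //.
- apply: measurableT_comp => //; apply: measurableT_comp => //.
  apply: measurable_funM => //; apply: measurable_funD => //.
  by apply: measurable_funM => //; apply: measurable_funB.
move=> u; rewrite /normal_fun -!expRD; congr expR.
rewrite expr1n.
have -> : (u - (m - t * x)) ^+ 2 =
   (u - m) ^+ 2 + 2 * t * x * (u - m) + t ^+ 2 * x ^+ 2 by ring.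
by rewrite x2; field.
Qed.

End normal_integral.

Section signed_sum.
Context d (T : measurableType d) (R : realType) (P : probability T R).
Context (I : finType) (D : {set I}) (X : I -> T -> R) (m : I -> R).
Hypothesis mX : forall i, measurable_fun setT (X i).
Hypothesis indX : mutually_independent P D X.
Hypothesis lawX : forall i, i \in D -> has_law P (X i) (normal_prob (m i) 1).
Context (F : nat -> R -> R).
Hypothesis mF : forall p, measurable_fun setT (F p).
Hypothesis F0 : forall p y, 0 <= F p y.
(** The index counts the Gaussian steps already averaged out. The result does not depend on the sign
    [x], which is why signs chosen from earlier coordinates do no harm. *)
Hypothesis F_step : forall p y x a, x ^+ 2 = 1 ->
  (\int[normal_prob a 1]_u (F p (y + x * (u - a)))%:E = (F p.+1 y)%:E)%E.

(* Integrating out one coordinate at a time: a step [i] of the sum is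
   independent of the signs and of the partial sum preceding it. *)
Lemma integral_signed_sum (x : I -> T -> R) (es : seq I) (J : {set I}) p
    (y : T -> R) :
  uniq es -> {in es, forall i, i \in D /\ i \notin J} -> J \subset D ->
  (forall i w, x i w ^+ 2 = 1) -> (forall i, i \in es -> adapted X J (x i)) ->
  adapted X J y ->
  (\int[P]_w (F p (y w + \sum_(i <- es) x i w * (X i w - m i)))%:E =
   \int[P]_w (F (p + size es) (y w))%:E)%E.
Proof.
elim: es J y p => [|i es IH] J y p /=.
  by move=> *; rewrite addn0; under eq_integral do rewrite big_nil addr0.
move=> /andP[ies ues] esD JD x2 ax ay.
have [iD iJ] := esD i (mem_head _ _).
have JJ : J \subset (i |: J)%SET by exact: finset.subsetUr.
under eq_integral do rewrite big_cons addrA.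
(* The tail is integrated out first: the increment of [i] is absorbed into the starting value, and
   [i] joins the known coordinates. *)
rewrite (IH (i |: J)%SET) //; last 4 first.
- move=> j jes; have [jD jJ] := esD j (mem_behead (s := i :: es) jes).
  split=> //; rewrite in_setU1 negb_or jJ andbT.
  by apply: contraNneq ies => <-.
- by rewrite finset.subUset finset.sub1set iD.
- move=> j jes; apply: sub_adapted JJ _; apply: ax.
  by rewrite in_cons jes orbT.
- apply: measurable_funD; first exact: sub_adapted JJ ay.
  apply: measurable_funM; first by apply: sub_adapted JJ _; apply: ax; exact: mem_head.
  by apply: measurable_funB => //; apply: adapted_coord; exact: setU11.
(* Both components are adapted to [J], so [X i] is the only fresh variable left. *)
pose z w := (y w, x i w).
pose G (v : (R * R) * measurableTypeR R) : \bar R :=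
  (F (p + size es) (v.1.1 + v.1.2 * (v.2 - m i)))%:E.
rewrite -[LHS]/(\int[P]_w G (z w, X i w))%E.
rewrite (integral_independent mX indX (J := J) (L := normal_prob (m i) 1)) //.
- by apply: eq_integral => w _; rewrite /G /z /= F_step // addnS.
- apply: measurable_fun_pair => //; apply: ax; exact: mem_head.
- exact: lawX.
- apply/measurable_EFinP; apply: measurableT_comp => //.
  apply: measurable_funD; first by apply: measurableT_comp.
  apply: measurable_funM; first by apply: measurableT_comp.
  by apply: measurable_funB => //; apply: measurable_snd.
- by move=> v; rewrite lee_fin.
Qed.

End signed_sum.

Section gaussian_signed_sum.
Context d (T : measurableType d) (R : realType) (P : probability T R).
Context (I : finType) (D : {set I}) (X : I -> T -> R) (m : I -> R).
Hypothesis mX : forall i, measurable_fun setT (X i).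
Hypothesis indX : mutually_independent P D X.
Hypothesis lawX : forall i, i \in D -> has_law P (X i) (normal_prob (m i) 1).

(** Given the coordinates in [J], the signs are constants and the sum is N(0, p) with p = [size es];
    the right side is the Laplace transform of the square of such a variable. *)
Lemma integral_expR_sqr_signed_sum (x : I -> T -> R) (es : seq I) (J : {set I})
    (l : R) :
  0 <= l ->
  uniq es -> {in es, forall i, i \in D /\ i \notin J} -> J \subset D ->
  (forall i w, x i w ^+ 2 = 1) -> (forall i, i \in es -> adapted X J (x i)) ->
  (\int[P]_w (expR (- (l * (\sum_(i <- es) x i w * (X i w - m i)) ^+ 2 / 2)))%:E =
   ((Num.sqrt (1 + (size es)%:R * l))^-1)%:E)%E.
Proof.
move=> l0 ues esD JD x2 ax.
(* The mean of exp(- l (y + N)^2 / 2) for N of law N(0, p). *)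
pose F (p : nat) y : R := (Num.sqrt (1 + p%:R * l))^-1 *
  expR (- (l / (1 + p%:R * l) * y ^+ 2 / 2)).
have pl p : 0 < 1 + p%:R * l by rewrite ltr_pwDl // mulr_ge0.
have mF p : measurable_fun setT (F p).
  apply: measurable_funM => //; apply: measurableT_comp => //.
  apply: measurableT_comp => //.
  by apply: measurable_funM => //; apply: measurable_funM => //; exact: measurable_funX.
have F0 p y : 0 <= F p y by rewrite mulr_ge0 ?invr_ge0 ?sqrtr_ge0 ?expR_ge0.
have F_step p y x' a : x' ^+ 2 = 1 ->
    (\int[normal_prob a 1]_u (F p (y + x' * (u - a)))%:E = (F p.+1 y)%:E)%E.
  move=> x'2; have := pl p; have := pl p.+1; rewrite /F -natr1 => p1 p0.
  under eq_integral do rewrite EFinM.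
  rewrite ge0_integralZl ?lee_fin ?invr_ge0 ?sqrtr_ge0 ?expR_ge0 //; last first.
    apply/measurable_EFinP; apply: measurableT_comp => //.
    apply: measurableT_comp => //; apply: measurable_funM => //.
    apply: measurable_funM => //; apply: measurable_funX.
    by apply: measurable_funD => //; apply: measurable_funM => //; apply: measurable_funB.
  rewrite integral_normal_expR_sqr //; last by rewrite divr_ge0 // ltW.
  rewrite -EFinM mulrA -invfM -sqrtrM ?ltW //; congr ((Num.sqrt _)^-1 * expR _)%:E.
    by field; rewrite gt_eqF.
  by congr (- (_ * _ / _)); field; rewrite !gt_eqF // -?natr1; lra.
transitivity (\int[P]_w (F 0%N (0 + \sum_(i <- es) x i w * (X i w - m i)))%:E)%E.
  by apply: eq_integral => w _; rewrite /F mul0r !addr0 sqrtr1 invr1 mul1r add0r mulr1.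
rewrite (integral_signed_sum mX indX lawX mF F0 F_step (y := fun=> 0) _
  ues esD JD x2 ax) //; last exact: measurable_cst.
rewrite /F expr0n /= mulr0 mul0r oppr0 expR0 mulr1 add0n.
by rewrite integral_cst //= probability_setT mule1.
Qed.

(** The same scheme with all signs equal to 1 and nothing revealed beforehand; [F p y] is now the
    mean of exp(- t (y + N)) for N of law N(0, p). *)
Lemma integral_expR_sum (es : seq I) (t : R) :
  uniq es -> {subset es <= D} ->
  (\int[P]_w (expR (- (t * \sum_(i <- es) (X i w - m i))))%:E =
   (expR ((size es)%:R * (t ^+ 2 / 2)))%:E)%E.
Proof.
move=> ues esD.
pose F (p : nat) y : R := expR (p%:R * (t ^+ 2 / 2) - t * y).
have mF p : measurable_fun setT (F p).
  by apply: measurableT_comp => //; apply: measurable_funB => //; exact: measurable_funM.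
have F0 p y : 0 <= F p y by exact: expR_ge0.
have F_step p y x' a : x' ^+ 2 = 1 ->
    (\int[normal_prob a 1]_u (F p (y + x' * (u - a)))%:E = (F p.+1 y)%:E)%E.
  move=> x'2; rewrite /F.
  under eq_integral do rewrite expRD EFinM.
  rewrite ge0_integralZl ?lee_fin ?invr_ge0 ?sqrtr_ge0 ?expR_ge0 //; last first.
    apply/measurable_EFinP; apply: measurableT_comp => //.
    apply: measurableT_comp => //; apply: measurable_funM => //.
    by apply: measurable_funD => //; apply: measurable_funM => //; apply: measurable_funB.
  rewrite integral_normal_expR // -EFinM -expRD -natr1.
  by congr (expR _)%:E; ring.
transitivity (\int[P]_w (F 0%N (0 + \sum_(i <- es) 1 * (X i w - m i)))%:E)%E.
  apply: eq_integral => w _; rewrite /F mul0r !add0r.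
  by under [in RHS]eq_bigr do rewrite mul1r.
rewrite (integral_signed_sum mX indX lawX mF F0 F_step (x := fun _ _ => 1)
  (J := finset.set0) (y := fun=> 0) _ ues) //.
- by rewrite /F mulr0 subr0 add0n integral_cst //= probability_setT mule1.
- by move=> i /esD; rewrite finset.in_set0.
- by rewrite finset.sub0set.
- by move=> *; rewrite expr1n.
all: move=> *; exact: measurable_cst.
Qed.

End gaussian_signed_sum.

(** * Greedy signs *)

Section greedy.
Context (R : realType) (n : nat).
Implicit Types (b : 'I_n -> 'I_n -> R) (x : 'I_n -> R).

(** The value at 0 is 1 rather than 0, so that the square is always 1. *)
Definition unit_sign (s : R) : R := if 0 <= s then 1 else -1.

Lemma unit_sign_sqr s : unit_sign s ^+ 2 = 1.
Proof. by rewrite /unit_sign; case: ifP; rewrite ?sqrrN expr1n. Qed.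

Lemma mulr_unit_sign s : s * unit_sign s = `|s|.
Proof.
rewrite /unit_sign; case: ifPn => [s0|]; first by rewrite mulr1 ger0_norm.
by rewrite -ltNge mulrN1 => s0; rewrite ltr0_norm.
Qed.

(* [greedy_iter b p j] is the sign chosen at step [j] once [p > j]; below that
   its value is irrelevant. *)
Fixpoint greedy_iter b (p : nat) (j : 'I_n) : R :=
  if p is p'.+1 then
    unit_sign (\sum_(i < n | (i < j)%N) greedy_iter b p' i * b i j)
  else 1.

Definition greedy b := greedy_iter b n.

Definition greedy_gain b (j : 'I_n) : R :=
  \sum_(i < n | (i < j)%N) greedy b i * b i j.

Lemma greedy_iter_stable b p q (j : 'I_n) : (j < p)%N -> (j < q)%N ->
  greedy_iter b p j = greedy_iter b q j.
Proof.
elim: p q j => // p IH [//|q] j jp jq /=; congr unit_sign.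
by apply: eq_bigr => i ij; rewrite (IH q) //; exact: leq_trans ij _.
Qed.

Lemma greedyE b j : greedy b j = unit_sign (greedy_gain b j).
Proof.
(* All signs are settled after [n] rounds; passing to [n.+1] rounds exposes one unfolding on top of
   [greedy]. *)
by rewrite /greedy (@greedy_iter_stable b n n.+1) // ltnS ltnW.
Qed.

Lemma greedy_sqr b j : greedy b j ^+ 2 = 1.
Proof. by rewrite greedyE unit_sign_sqr. Qed.

Lemma sum_greedy b :
  \sum_(j < n) \sum_(i < n | (i < j)%N) b i j * (greedy b i * greedy b j) =
  \sum_(j < n) `|greedy_gain b j|.
Proof.
apply: eq_bigr => j _; rewrite -mulr_unit_sign -greedyE mulr_suml.
by apply: eq_bigr => i _; ring.
Qed.

Definition weight b (Q : {set 'I_n}) : R :=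
  \sum_(i < n) \sum_(j < n | (i < j)%N) b i j * ((i \in Q) && (j \in Q))%:R.

(** For signs, (1 + x_i x_j) / 2 is the indicator that [i] and [j] lie in the same half. *)
Lemma weight_halves b x : (forall i, x i ^+ 2 = 1) ->
  weight b [set i | 0 <= x i]%SET + weight b (~: [set i | 0 <= x i])%SET =
  (\sum_(j < n) \sum_(i < n | (i < j)%N) b i j +
   \sum_(j < n) \sum_(i < n | (i < j)%N) b i j * (x i * x j)) / 2.
Proof.
move=> x2; have xE i : x i = if 0 <= x i then 1 else -1.
  have : (x i - 1) * (x i + 1) = 0 by have := x2 i; move: (x i) => y; lra.
  move/eqP; rewrite mulf_eq0 subr_eq0 addr_eq0 => /orP[]/eqP ->.
    by rewrite ler01.
  by rewrite oppr_ge0 ler10.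
have ex (F : 'I_n -> 'I_n -> R) : \sum_(j < n) \sum_(i < n | (i < j)%N) F i j =
    \sum_(i < n) \sum_(j < n | (i < j)%N) F i j by exact: exchange_big_dep.
rewrite !ex /weight -!big_split /= mulr_suml; apply: eq_bigr => i _.
rewrite -!big_split /= mulr_suml; apply: eq_bigr => j _.
rewrite !finset.in_setC !finset.inE.
by move: (xE i) (xE j); case: (0 <= x i) => ->; case: (0 <= x j) => -> /=; field.
Qed.

Lemma exists_heavy_subset b : exists Q : {set 'I_n},
  (\sum_(j < n) \sum_(i < n | (i < j)%N) b i j +
   \sum_(j < n) `|greedy_gain b j|) / 4 <= weight b Q.
Proof.
have := weight_halves b (greedy_sqr b); rewrite sum_greedy.
set Q := [set i | _]%SET => h.
by have [?|?] := leP (weight b (~: Q)%SET) (weight b Q);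
  [exists Q|exists (~: Q)%SET]; lra.
Qed.

End greedy.

(** Telescoping: with a and b the square roots of n and n + 1, the bound 1 / b <= 2 (b - a) amounts
    to (b - a)^2 >= 0, because b^2 = a^2 + 1. *)
Lemma sum_inv_sqrt_le (R : realType) (n : nat) :
  \sum_(j < n) (Num.sqrt (j.+1%:R : R))^-1 <= 2 * Num.sqrt n%:R.
Proof.
elim: n => [|n IH]; first by rewrite big_ord0 mulr_ge0 // sqrtr_ge0.
rewrite big_ord_recr /=; apply: le_trans (lerD IH (lexx _)) _.
set a := Num.sqrt n%:R; set b := Num.sqrt n.+1%:R.
have b0 : 0 < b by rewrite sqrtr_gt0.
have a0 : 0 <= a by rewrite sqrtr_ge0.
have ab : b ^+ 2 = a ^+ 2 + 1 by rewrite !sqr_sqrtr // -natr1.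
rewrite -lerBrDl -[b^-1]mul1r ler_pdivrMr // -subr_ge0.
have -> : (2 * b - 2 * a) * b - 1 = (b - a) ^+ 2 by rewrite sqrrB ab; lra.
exact: sqr_ge0.
Qed.

Lemma measurable_unit_sign (R : realType) : measurable_fun setT (@unit_sign R).
Proof.
by apply: measurable_fun_ifT => //; exact: measurable_fun_ler.
Qed.

(** * ** A heavy subset exists with high probability *)

Section heavy_subset.
Context (n : nat) d (T : measurableType d) (R : realType) (P : probability T R).
Context (X : 'I_n * 'I_n -> T -> R) (m : 'I_n * 'I_n -> R).
Hypothesis mX : forall e, measurable_fun setT (X e).
Hypothesis indX : mutually_independent P (upper_pairs n) X.
Hypothesis lawX : forall e, e \in upper_pairs n ->
  has_law P (X e) (normal_prob (m e) 1).

Local Notation centered w := (fun i j => X (i, j) w - m (i, j)).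

Definition pairs_below (k : nat) : {set 'I_n * 'I_n} :=
  [set e : 'I_n * 'I_n | (e.1 < e.2)%N && (e.2 < k)%N]%SET.

(** The sign of [j] uses column [j] itself and, through the earlier signs, the columns before it;
    hence the bound [j.+1]. *)
Lemma adapted_greedy_iter p (j : 'I_n) :
  adapted X (pairs_below j.+1) (fun w => greedy_iter (centered w) p j).
Proof.
elim: p j => [|p IH] j; first exact: measurable_cst.
apply: measurableT_comp; first exact: measurable_unit_sign.
rewrite [X in measurable_fun _ X](_ : _ = fun w => \sum_(i <- index_enum 'I_n)
  if (i < j)%N then greedy_iter (centered w) p i * (X (i, j) w - m (i, j)) else 0);
  last by apply/funext => w; rewrite -big_mkcond.
apply: measurable_sum => i; case: (boolP (i < j)%N) => // ij.
apply: measurable_funM.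
  apply: sub_adapted (IH i); apply/fintype.subsetP => e.
  rewrite !finset.inE => /andP[e12 e2i]; rewrite e12 /=.
  exact: leq_trans e2i (ltnW _).
apply: measurable_funB => //; apply: adapted_coord.
by rewrite !finset.inE /= ij ltnS /=.
Qed.

Definition column (j : 'I_n) : seq ('I_n * 'I_n) :=
  [seq (i, j) | i <- [seq i : 'I_n <- index_enum 'I_n | (i < j)%N]].

Lemma greedy_gainE w (j : 'I_n) : greedy_gain (centered w) j =
  \sum_(e <- column j) greedy (centered w) e.1 * (X e w - m e).
Proof. by rewrite big_map big_filter. Qed.

Lemma size_column (j : 'I_n) : size (column j) = j.
Proof.
rewrite size_map size_filter -sum1_count.
rewrite (big_ord_narrow (F := fun=> 1%N) (ltnW (ltn_ord j))).
by rewrite sum1_card card_ord.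
Qed.

(** The signs multiplying column [j] belong to indices i < j, so they are determined by the columns
    before [j], while column [j] is still fresh. *)
Lemma integral_greedy_gain (l : R) (j : 'I_n) : 0 <= l ->
  (\int[P]_w (expR (- (l * greedy_gain (centered w) j ^+ 2 / 2)))%:E =
   ((Num.sqrt (1 + j%:R * l))^-1)%:E)%E.
Proof.
move=> l0; under eq_integral do rewrite greedy_gainE.
rewrite (integral_expR_sqr_signed_sum mX indX lawX
  (x := fun e w => greedy (centered w) e.1) (J := pairs_below j)) //.
- by rewrite size_column.
- rewrite map_inj_uniq ?filter_uniq ?index_enum_uniq // => i i' [].
- by [].
- move=> e /mapP[i]; rewrite mem_filter => /andP[ij _] ->.
  by rewrite !finset.inE /= ij ltnn.
- apply/fintype.subsetP => e; rewrite !finset.inE => /andP[-> _] //.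
- by move=> e w; exact: greedy_sqr.
- move=> e /mapP[i]; rewrite mem_filter => /andP[ij _] -> /=.
  apply: (@sub_adapted _ _ _ _ _ (pairs_below i.+1)); last exact: adapted_greedy_iter.
  apply/fintype.subsetP => f.
  rewrite !finset.inE => /andP[f12 f2i]; rewrite f12 /=.
  exact: leq_trans f2i ij.
Qed.

Lemma measurable_greedy_gain (j : 'I_n) :
  measurable_fun setT (fun w => greedy_gain (centered w) j).
Proof.
rewrite [X in measurable_fun _ X](_ : _ = fun w => \sum_(e <- column j)
  greedy (centered w) e.1 * (X e w - m e)); last first.
  by apply/funext => w; exact: greedy_gainE.
apply: measurable_sum => e; apply: measurable_funM; last exact: measurable_funB.
apply: (adapted_measurable mX (J := pairs_below e.1.+1)).
exact: adapted_greedy_iter.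
Qed.

(** The total is a centered Gaussian of variance at most n^2, so scaling it by 1 / n leaves an
    exponent of at most 1/2. *)
Lemma integral_total_weight : (0 < n)%N ->
  (\int[P]_w (expR (- (n%:R^-1 *
     \sum_(j < n) \sum_(i < n | (i < j)%N) (X (i, j) w - m (i, j)))))%:E
   <= (expR (1 / 2))%:E)%E.
Proof.
move=> n0; have upE w : \sum_(j < n) \sum_(i < n | (i < j)%N)
    (X (i, j) w - m (i, j)) = \sum_(e <- enum (upper_pairs n)) (X e w - m e).
  rewrite big_enum /= (exchange_big_dep predT) //= pair_big_dep /=.
  by apply: eq_big => [e|[i j] _] //; rewrite finset.inE.
under eq_integral do rewrite upE.
rewrite (integral_expR_sum mX indX lawX) ?enum_uniq //; last first.
  by move=> e; rewrite mem_enum.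
rewrite -cardE lee_fin ler_expR mulrA ler_pM2r // exprVn.
rewrite ler_pdivrMr ?exprn_gt0 ?ltr0n //.
rewrite mul1r -natrX ler_nat (leq_trans (max_card _)) //.
by rewrite card_prod card_ord.
Qed.

(** Markov's inequality for a single variable [Z] that controls both failures at once: too many
    small gains, and a very negative total. *)
Lemma heavy_subset_prob (t : R) : (0 < n)%N -> 1 <= t ->
  exists E : set T, [/\ measurable E,
    (P E <= (8 * t / Num.sqrt n%:R + expR (1 / 2 - t / 4))%:E)%E &
    forall w, ~ E w -> exists Q : {set 'I_n},
      t * n%:R / 16 <= weight (centered w) Q].
Proof.
move=> n0 t1; have t0 : 0 < t by exact: lt_le_trans t1.
have nR : 0 < n%:R :> R by rewrite ltr0n.
(* At this scale [u j] is at least 1/2 whenever the gain of [j] is at most [t] in absolute value. *)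
pose l := (t ^+ 2)^-1; have l0 : 0 <= l by rewrite invr_ge0 sqr_ge0.
pose u (j : 'I_n) w := expR (- (l * greedy_gain (centered w) j ^+ 2 / 2)).
pose S w := \sum_(j < n) \sum_(i < n | (i < j)%N) (X (i, j) w - m (i, j)).
pose v w := expR (- (n%:R^-1 * S w)).
(* The coefficients are such that Z < 1 forces the sum of the [u j] below n / 4 and the total [S]
   above - t n / 4. *)
pose Z w := 4 / n%:R * \sum_(j < n) u j w + expR (- (t / 4)) * v w.
have mu j : measurable_fun setT (u j).
  apply: measurableT_comp => //; apply: measurableT_comp => //.
  apply: measurable_funM => //; apply: measurable_funM => //.
  by apply: measurable_funX; exact: measurable_greedy_gain.
have mv : measurable_fun setT v.
  apply: measurableT_comp => //; apply: measurableT_comp => //.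
  apply: measurable_funM => //; apply: measurable_sum => j.
  rewrite [X in measurable_fun _ X](_ : _ = fun w => \sum_(i <- index_enum 'I_n)
    if (i < j)%N then (X (i, j) w - m (i, j)) else 0);
    last by apply/funext => w; rewrite -big_mkcond.
  by apply: measurable_sum => i; case: (i < j)%N => //; exact: measurable_funB.
have msu : measurable_fun setT (fun w => \sum_(j < n) u j w).
  by apply: measurable_sum.
have u0 j w : 0 <= u j w by exact: expR_ge0.
have v0 w : 0 <= v w by exact: expR_ge0.
have su0 w : 0 <= \sum_(j < n) u j w by exact: sumr_ge0.
have mZ : measurable_fun setT Z.
  by apply: measurable_funD; exact: measurable_funM.
have Z0 w : 0 <= Z w.
  by rewrite addr_ge0 // mulr_ge0 // ?expR_ge0 // divr_ge0 // ltW.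
have mE : measurable [set w | 1 <= Z w].
  rewrite -[X in measurable X]setTI.
  have -> : [set w | 1 <= Z w] = Z @^-1` `[1, +oo[%classic.
    by apply/seteqP; split=> w; rewrite /= in_itv /= andbT.
  exact: mZ.
exists [set w | 1 <= Z w]; split=> //.
  rewrite -[X in P X]setIT -integral_indic //.
  apply: (@le_trans _ _ (\int[P]_w (Z w)%:E)%E).
    apply: ge0_le_integral => //.
    - by apply/measurable_EFinP.
    - by apply/measurable_EFinP.
    move=> w _; rewrite lee_fin indicE; case: (boolP (_ \in _)) => //.
    by rewrite inE.
  under eq_integral do rewrite EFinD !EFinM -sumEFin.
  rewrite ge0_integralD //; last 4 first.
  - by move=> w _; rewrite sumEFin -EFinM lee_fin mulr_ge0 // divr_ge0 // ltW.
  - apply/measurable_funeM/emeasurable_sum => j; exact/measurable_EFinP.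
  - by move=> w _; rewrite -EFinM lee_fin mulr_ge0 // expR_ge0.
  - by apply/measurable_funeM/measurable_EFinP.
  rewrite ge0_integralZl; last 4 first.
  - by [].
  - by apply: emeasurable_sum => j; exact/measurable_EFinP.
  - by move=> w _; rewrite sumEFin lee_fin.
  - by rewrite -EFinM lee_fin divr_ge0 // ltW.
  rewrite ge0_integralZl ?lee_fin ?expR_ge0 //; last 2 first.
  - exact/measurable_EFinP.
  - by move=> w _; rewrite lee_fin.
  rewrite ge0_integral_sum //; last 2 first.
  - by move=> j; exact/measurable_EFinP.
  - by move=> j w _; rewrite lee_fin.
  rewrite -[leRHS]/((8 * t / Num.sqrt n%:R)%:E + (expR (1 / 2 - t / 4))%:E)%E.
  apply: leeD.
    under eq_bigr do rewrite integral_greedy_gain //.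
    rewrite sumEFin -!EFinM lee_fin.
    apply: (@le_trans _ _ (4 / n%:R * (t * (2 * Num.sqrt n%:R)))).
      apply: ler_wpM2l; first by rewrite divr_ge0 // ltW.
      apply: (le_trans _ (ler_wpM2l (ltW t0) (sum_inv_sqrt_le R n))).
      rewrite mulr_sumr; apply: ler_sum => j _.
      (* After inverting and squaring, the claim is (j + 1) / t^2 <= 1 + j / t^2, which is where t
         >= 1 enters. *)
      rewrite -[t in leRHS]invrK -invfM lef_pV2 ?posrE; last 2 first.
      - by rewrite sqrtr_gt0 ltr_pwDl // mulr_ge0.
      - by rewrite mulr_gt0 ?invr_gt0 ?sqrtr_gt0.
      rewrite -[t^-1]gtr0_norm ?invr_gt0 // -sqrtr_sqr -sqrtrM ?sqr_ge0 //.
      rewrite ler_wsqrtr // exprVn -/l mulrC -natr1 mulrDl mul1r addrC lerD2r.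
      by rewrite invf_le1 ?exprn_gt0 // exprn_ege1.
    have sn : 0 < Num.sqrt n%:R :> R by rewrite sqrtr_gt0.
    have sn2 : n%:R = Num.sqrt n%:R ^+ 2 :> R by rewrite sqr_sqrtr // ltW.
    rewrite [X in 4 / X]sn2 le_eqVlt; apply/orP; left; apply/eqP.
    by field; rewrite gt_eqF.
  apply: le_trans (lee_wpmul2l _ (integral_total_weight n0)) _.
    by rewrite lee_fin expR_ge0.
  by rewrite -EFinM -expRD lee_fin ler_expR; lra.
move=> w /= /negP; rewrite -ltNge => Z1.
have [Q hQ] := exists_heavy_subset (centered w); exists Q; apply: le_trans hQ.
rewrite -/(S w).
have U4 : 4 / n%:R * \sum_(j < n) u j w < 1.
  by apply: le_lt_trans Z1; rewrite lerDl mulr_ge0 // expR_ge0.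
have V1 : expR (- (t / 4)) * v w < 1.
  by apply: le_lt_trans Z1; rewrite lerDr mulr_ge0 // divr_ge0 // ltW.
have Sn : - (t * n%:R / 4) < S w.
  move: V1; rewrite -expRD -[ltRHS]expR0 ltr_expR => V1.
  have : - (t / 4) < n%:R^-1 * S w by lra.
  by rewrite [ltRHS]mulrC ltr_pdivlMr //; lra.
(* Together with [Sn] this leaves (t n / 2 - t n / 4) / 4 = t n / 16 for the heavy subset. *)
have Wn : t * n%:R / 2 <= \sum_(j < n) `|greedy_gain (centered w) j|.
  have U : \sum_(j < n) u j w <= n%:R / 4.
    by move: U4; rewrite mulrAC ltr_pdivrMr // mul1r; lra.
  (* Termwise bound: a gain of size at least [t] suffices since [u j] is nonnegative, and for a
     smaller gain [u j] >= 1/2 makes the right side nonpositive. *)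
  apply: (@le_trans _ _ (\sum_(j < n) t * (1 - 2 * u j w))).
    rewrite -mulr_sumr sumrB -mulr_sumr sumr_const card_ord.
    by rewrite -mulrA; apply: ler_wpM2l; [exact: ltW|lra].
  apply: ler_sum => j _; have := u0 j w; rewrite /u.
  set s := greedy_gain _ _ => u0'.
  have [st|st] := leP t `|s|.
    by apply: le_trans st; apply: ler_piMr; [exact: ltW|lra].
  apply: (@le_trans _ _ 0) => //; rewrite pmulr_rle0 // subr_le0.
  have : 1 - l * s ^+ 2 / 2 <= expR (- (l * s ^+ 2 / 2)) by exact: expR_ge1Dx.
  suff : l * s ^+ 2 <= 1 by lra.
  rewrite /l mulrC ler_pdivrMr ?exprn_gt0 // mul1r -[s ^+ 2]real_normK ?num_real //.
  by apply: lerXn2r; rewrite ?nnegrE ?(ltW t0) ?(ltW st).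
lra.
Qed.

End heavy_subset.

(** * Measurability of the test *)

Lemma continuous_sumr (R : realType) (Y : topologicalType) (I : Type)
    (r : seq I) (Q : pred I) (f : I -> Y -> R) :
  (forall i, continuous (f i)) ->
  continuous (fun y => \sum_(i <- r | Q i) f i y).
Proof.
move=> cf y; elim: r => [|i r IH].
  have -> : (fun y => \sum_(i <- [::] | Q i) f i y) = fun=> 0.
    by apply/funext => z; rewrite big_nil.
  exact: cvg_cst.
have -> : (fun y => \sum_(k <- i :: r | Q k) f k y) =
    fun y => if Q i then f i y + \sum_(k <- r | Q k) f k y
             else \sum_(k <- r | Q k) f k y.
  by apply/funext => z; rewrite big_cons.
by case: (Q i) => //; apply: cvgD; [exact: cf|exact: IH].
Qed.

Section linear_functional.
Context (R : realType) (S : eqType).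
Local Notation Y := {ptws S -> R}.

Lemma continuous_coordinate (t : S) : continuous (fun Z : Y => Z t : R).
Proof. exact: (@proj_continuous S (fun=> R) t). Qed.

Lemma continuous_linear_form (I : finType) (Q : pred I) (s : I -> S)
    (a : I -> R) : continuous (fun Z : Y => \sum_(i | Q i) a i * Z (s i)).
Proof.
apply: (@continuous_sumr R Y I (index_enum I) Q (fun i (Z : Y) => a i * Z (s i))).
move=> i Z.
apply: (@cvgM R Y (nbhs Z) _ (fun=> a i) (fun Z : Y => Z (s i))).
  exact: cvg_cst.
exact: continuous_coordinate.
Qed.

End linear_functional.

Section measurability.
Context d (T : measurableType d) (R : realType) (I : finType) (f : I -> T -> R).
Hypothesis mf : forall i, measurable_fun setT (f i).

(** An open set is the union of the boxes with rational center and radius 1 / (N + 1) that it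
    contains, and there are countably many of them. *)
Lemma measurable_preimage_sup_open (U : set (I -> R)) :
  (forall a, U a -> exists2 e : R, 0 < e &
     forall b, (forall i, `|b i - a i| < e) -> U b) ->
  measurable [set w | U (f ^~ w)].
Proof.
move=> oU.
pose box (p : {ffun I -> rat} * nat) (a : I -> R) :=
  forall i, `|a i - ratr (p.1 i)| < p.2.+1%:R^-1.
have -> : [set w | U (f ^~ w)] =
    \bigcup_p [set w | box p (f ^~ w) /\ box p `<=` U].
  apply/seteqP; split=> w /=; last by move=> [p _ [fw]]; apply.
  move=> /oU[e e0 eU]; have e2 : 0 < e / 2 by lra.
  (* Two points of a box differ in each coordinate by less than twice its radius. *)
  have [N Ne] : exists N : nat, N.+1%:R^-1 < e / 2.
    by exists (Num.truncn (e / 2)^-1); rewrite invf_plt ?posrE // truncnS_gt.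
  have N0 : 0 < N.+1%:R^-1 :> R by rewrite invr_gt0.
  have rP i : {q : rat | `|f i w - ratr q| < N.+1%:R^-1}.
    apply: cid; have [|q] := @rat_in_itvoo R (f i w - N.+1%:R^-1) (f i w).
      by rewrite ltrBlDr ltrDl.
    rewrite in_itv /= => /andP[q1 q2]; exists q.
    by rewrite gtr0_norm ?subr_gt0 // ltrBlDr -ltrBlDl.
  exists ([ffun i => sval (rP i)], N) => //; split=> [i|a Ba] /=.
    by rewrite ffunE; exact: svalP (rP i).
  apply: eU => i; have := svalP (rP i); have := Ba i; rewrite /= ffunE.
  move: (ratr _) => q; move: N0 Ne; rewrite !ltr_norml.
  move: (N.+1%:R^-1) => g; lra.
apply: countable_bigcupT_measurable => [|p]; first exact: countableP.
have [bU|nbU] := pselect (box p `<=` U); last first.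
  rewrite (_ : [set w | _] = set0) //.
  by apply/seteqP; split=> w // [].
rewrite (_ : [set w | _] = \bigcap_(i in [set: I])
    (f i @^-1` [set x | `|x - ratr (p.1 i)| < p.2.+1%:R^-1])); last first.
  by apply/seteqP; split=> w /= => [[h _] i _|h]; [exact: h|split=> // i; exact: h].
apply: fin_bigcap_measurable => // i _.
rewrite -[X in measurable X]setTI; apply: mf => //.
rewrite (_ : [set x | _] = `](ratr (p.1 i) - p.2.+1%:R^-1),
    (ratr (p.1 i) + p.2.+1%:R^-1)[%classic) //.
apply/seteqP; split=> x; rewrite /= in_itv /= ltr_norml; move: (_^-1) => g; lra.
Qed.

(** The existential ranges over an uncountable set, so measurability goes through the complement.
    The coefficients whose form stays below [c] on all of [K] make an open set: compactness gives a
    uniform margin, and [Z] valued in [0, 1] turns it into a sup-norm radius. *)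
Lemma measurable_compact_maximum (S : eqType) (s : I -> S) (Q : pred I)
    (K : set {ptws S -> R}) (c : R) :
  compact K -> (forall Z, K Z -> forall i, 0 <= Z i <= 1) ->
  measurable [set w | exists2 Z, K Z & c <= \sum_(i | Q i) f i w * Z (s i)].
Proof.
move=> cK K01.
rewrite (_ : [set w | _] = ~` [set w | [set a : I -> R | forall Z, K Z ->
    \sum_(i | Q i) a i * Z (s i) < c] (f ^~ w)]); last first.
  apply/seteqP; split=> w /=.
    by move=> [Z KZ cZ] /(_ Z KZ); rewrite ltNge cZ.
  move=> h; apply: contrapT => h'; apply: h => Z KZ.
  by rewrite ltNge; apply/negP => cZ; apply: h'; exists Z.
apply/measurableC/measurable_preimage_sup_open => a Ua.
pose C : R := #|I|%:R.
pose phi (b : I -> R) (Z : {ptws S -> R}) := \sum_(i | Q i) b i * Z (s i).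
have cphi : continuous (phi a) by exact: continuous_linear_form.
(* [C / (N + 1)] bounds the change of the form when each coefficient moves by less than 1 / (N + 1).
   Near each [Z], half of the gap to [c] absorbs the variation of [phi a] and half absorbs this
   term; compactness gives one [N] for all [Z]. *)
have [N _ HN] : \forall N \near \oo, K `<=` [set Z | phi a Z + C * N.+1%:R^-1 < c].
  move/compact_near_coveringP: cK; apply => Z KZ.
  have e0 : 0 < c - phi a Z by rewrite subr_gt0; exact: Ua.
  have e2 : 0 < (c - phi a Z) / 2 by lra.
  near=> Z' M.
  have h1 : phi a Z' < phi a Z + (c - phi a Z) / 2.
    near: Z'; have /cvgrPdist_lt/(_ _ e2) := cphi Z.
    by apply: filterS => Z'; rewrite ltr_norml => /=; lra.
  have h2 : C * M.+1%:R^-1 < (c - phi a Z) / 2.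
    near: M; have : C * x.+1%:R^-1 @[x --> \oo] --> (0 : R).
      rewrite -[X in _ --> X](mulr0 C); apply: cvgM; first exact: cvg_cst.
      exact: cvg_harmonic.
    move=> /cvgrPdist_lt/(_ _ e2); apply: filterS => M /=.
    by rewrite sub0r normrN => /(le_lt_trans (ler_norm _)).
  by rewrite /=; apply: lt_le_trans (ltrD h1 h2) _; lra.
have N0 : 0 < N.+1%:R^-1 :> R by rewrite invr_gt0.
exists N.+1%:R^-1 => // b ba Z KZ.
apply: le_lt_trans (HN N (leqnn N) Z KZ).
rewrite -lerBlDl /phi -sumrB.
apply: (@le_trans _ _ (\sum_(i | Q i) N.+1%:R^-1)).
  apply: ler_sum => i _; rewrite -mulrBl.
  have /andP[Z0 Z1] := K01 Z KZ (s i).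
  apply: le_trans (_ : `|b i - a i| * Z (s i) <= _).
    by rewrite ler_wpM2r // ler_norm.
  apply: le_trans (_ : `|b i - a i| * 1 <= _); first by rewrite ler_wpM2l.
  by rewrite mulr1 ltW.
rewrite sumr_const -[leLHS]mulr_natl ler_wpM2r ?ler_nat ?max_card //.
Unshelve. all: by end_near.
Qed.

End measurability.

Section closedness.
Context (R : realType) (Y : topologicalType).

Lemma closed_forall (I : Type) (P : I -> set Y) :
  (forall i, closed (P i)) -> closed [set y | forall i, P i y].
Proof.
move=> cP; rewrite (_ : [set y | _] = \bigcap_(i in setT) P i).
  exact: closed_bigI.
by apply/seteqP; split=> y /= h i; [move=> _|]; exact: h.
Qed.

Lemma closed_le_fun (g h : Y -> R) : continuous g -> continuous h ->
  closed [set y | g y <= h y].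
Proof.
move=> cg ch.
rewrite (_ : [set y | _] = (fun y => h y - g y) @^-1` [set x | 0 <= x]).
  apply: closed_comp; last exact: closed_ge.
  by move=> y _; apply: cvgB; [exact: ch|exact: cg].
by apply/seteqP; split=> y /=; rewrite subr_ge0.
Qed.

Lemma closed_eq_fun (g h : Y -> R) : continuous g -> continuous h ->
  closed [set y | g y = h y].
Proof.
move=> cg ch.
rewrite (_ : [set y | _] = [set y | g y <= h y] `&` [set y | h y <= g y]).
  by apply: closedI; exact: closed_le_fun.
apply/seteqP; split=> y /=; first by move=> ->.
by move=> [gh hg]; apply/eqP; rewrite eq_le gh hg.
Qed.

Lemma continuous_scale_lr (a b : R) (g : Y -> R) : continuous g ->
  continuous (fun y => a * g y * b).
Proof.
by move=> cg y; apply: cvgM; [apply: cvgM; [exact: cvg_cst|exact: cg]|exact: cvg_cst].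
Qed.

End closedness.

(** * ** Degree-4 moment matrices: compactness and feasibility *)

Section sos4.
Context (R : realType) (n : nat).
Implicit Types (A : 'M[R]_n).

Local Notation Y := {ptws (subsets_le2 n * subsets_le2 n)%type -> R}.

(** The set is closed in the cube of functions valued in [0, 1], which is compact by Tychonoff. *)
Lemma compact_sos4_moments (k : R) :
  compact [set Z : Y |
    sos4_moments (fun S1 S2 => Z (S1, S2)) /\
    \sum_(i < n) Z (singleS i, singleS i) <= k].
Proof.
have cp p : continuous (fun Z : Y => Z p : R).
  exact: continuous_coordinate.
have cc (c : R) : continuous (fun _ : Y => c) by exact: (@cst_continuous Y R c).
have cC : compact [set Z : Y | forall p, `[0 : R, 1]%classic (Z p)].
  exact: (@tychonoff _ (fun=> R) (fun=> `[0 : R, 1]%classic)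
    (fun=> @segment_compact R 0 1)).
apply: (subclosed_compact _ cC).
- rewrite (_ : [set Z : Y | _] =
    [set Z : Y | forall p, Z p = Z (p.2, p.1)] `&`
    [set Z : Y | forall v : subsets_le2 n -> R,
       0 <= \sum_i \sum_j v i * Z (i, j) * v j] `&`
    [set Z : Y | forall p, 0 <= Z p] `&`
    [set Z : Y | forall p, Z p <= 1] `&`
    [set Z : Y | Z (emptyS n, emptyS n) = 1] `&`
    (* Carrying the equation of unions in the index presents this constraint as an intersection of
       closed sets. *)
    [set Z : Y | forall q : {q : (subsets_le2 n * subsets_le2 n) *
         (subsets_le2 n * subsets_le2 n) |
         (sval q.1.1 :|: sval q.1.2 == sval q.2.1 :|: sval q.2.2)%SET},
       Z (sval q).1 = Z (sval q).2] `&`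
    [set Z : Y | \sum_(i < n) Z (singleS i, singleS i) <= k]).
    apply: closedI; last by apply: closed_le_fun => //; exact: continuous_sumr.
    apply: closedI; last by apply: closed_forall => q; exact: closed_eq_fun.
    apply: closedI; last exact: closed_eq_fun.
    apply: closedI; last by apply: closed_forall => q; exact: closed_le_fun.
    apply: closedI; last by apply: closed_forall => q; exact: closed_le_fun.
    apply: closedI; first by apply: closed_forall => q; exact: closed_eq_fun.
    apply: closed_forall => v; apply: closed_le_fun => //.
    apply: continuous_sumr => i; apply: continuous_sumr => j.
    by apply: (@continuous_scale_lr R Y (v i) (v j) (fun Z : Y => Z (i, j))).
  apply/seteqP; split=> Z /=.
    move=> [[[sZ pZ] Z01 Z1 ZU] Zk]; do ![split=> //].
    - by move=> [S1 S2]; exact: sZ.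
    - by move=> [S1 S2]; have /andP[] := Z01 S1 S2.
    - by move=> [S1 S2]; have /andP[] := Z01 S1 S2.
    - by move=> [[[S1 S2] [S3 S4]] /= /eqP]; exact: ZU.
  move=> [[[[[[sZ pZ] Z0] Z1] Ze] ZU] Zk]; split=> //; split=> //.
  - by move=> S1 S2; apply/andP; split; [exact: Z0|exact: Z1].
  - move=> S1 S2 S3 S4 /eqP h.
    exact: (ZU (exist _ ((S1, S2), (S3, S4)) h)).
- by move=> Z [[_ Z01 _ _] _] [S1 S2] /=; rewrite in_itv /=; exact: Z01.
Qed.

Lemma measurable_sos4_test d (T : measurableType d) (cstar mu : R) (k : nat)
    (A : T -> 'M[R]_n) :
  (forall i j, measurable_fun setT (fun w => A w i j)) ->
  measurable [set w | sos4_test cstar mu k (A w) = true].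
Proof.
move=> mA.
pose f (p : 'I_n * 'I_n) w := A w p.1 p.2.
have := @measurable_compact_maximum _ T R _ f (fun p => mA p.1 p.2)
  (subsets_le2 n * subsets_le2 n)%type (fun p => (singleS p.1, singleS p.2))
  (fun p => (p.1 < p.2)%N) _ (cstar * mu * k%:R ^+ 2) (@compact_sos4_moments k%:R).
move=> h; rewrite (_ : [set w | _] = [set w | exists2 Z : Y,
    sos4_moments (fun S1 S2 => Z (S1, S2)) /\
      \sum_(i < n) Z (singleS i, singleS i) <= k%:R &
    cstar * mu * k%:R ^+ 2 <=
    \sum_(p : 'I_n * 'I_n | (p.1 < p.2)%N) f p w * Z (singleS p.1, singleS p.2)]).
  by apply: h => Z [[_ Z01 _ _] _] [S1 S2]; exact: Z01.
apply/seteqP; split=> w /=.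
  move=> /asboolP[X [X4 Xk Xc]]; exists (fun p => X p.1 p.2) => //.
  by move: Xc; rewrite pair_big_dep.
move=> [Z [Z4 Zk] Zc]; apply/asboolP; exists (fun S1 S2 => Z (S1, S2)).
by split=> //; rewrite pair_big_dep.
Qed.

Lemma sos4_test_of_weight A (Q : {set 'I_n}) (cstar mu : R) (k : nat) :
  (0 < n)%N -> (k <= n)%N ->
  cstar * mu * k%:R * n%:R <= weight A Q -> sos4_test cstar mu k A.
Proof.
move=> n0 kn hQ; have nR : 0 < n%:R :> R by rewrite ltr0n.
pose p : R := k%:R / n%:R.
have p0 : 0 <= p by rewrite divr_ge0.
have p1 : p <= 1 by rewrite ler_pdivrMr // mul1r ler_nat.
(* [e] and [q] list the monomials evaluated at the empty set and at [Q]. The mixture [X] is a sum of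
   two rank-one matrices with nonnegative weights, hence positive semidefinite. *)
pose e (S : subsets_le2 n) : R := (sval S \subset finset.set0)%:R.
pose q (S : subsets_le2 n) : R := (sval S \subset Q)%:R.
pose X S1 S2 := (1 - p) * (e S1 * e S2) + p * (q S1 * q S2).
(* Products of evaluations depend only on the union, which yields the consistency constraint. *)
have eE S1 S2 : e S1 * e S2 = ((sval S1 :|: sval S2)%SET \subset finset.set0)%:R.
  by rewrite finset.subUset -mulnb natrM.
have qE S1 S2 : q S1 * q S2 = ((sval S1 :|: sval S2)%SET \subset Q)%:R.
  by rewrite finset.subUset -mulnb natrM.
apply/asboolP; exists X; split.
- split.
  + split=> [S1 S2|v]; first by rewrite /X; ring.
    have -> : \sum_S1 \sum_S2 v S1 * X S1 S2 * v S2 =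
        (1 - p) * (\sum_S v S * e S) ^+ 2 + p * (\sum_S v S * q S) ^+ 2.
      rewrite !expr2 !mulr_suml !mulr_sumr -big_split /=; apply: eq_bigr => S1 _.
      rewrite !mulr_sumr -big_split /=; apply: eq_bigr => S2 _.
      by rewrite /X; ring.
    by rewrite addr_ge0 // mulr_ge0 ?sqr_ge0 ?subr_ge0.
  + move=> S1 S2; rewrite /X eE qE.
    by case: (_ \subset _); case: (_ \subset _); rewrite /= ?mulr1 ?mulr0; lra.
  + by rewrite /X /e /q /= !finset.sub0set !mulr1 subrK.
  + by move=> S1 S2 S3 S4 h; rewrite /X !eE !qE h.
- have Xk (i : 'I_n) : X (singleS i) (singleS i) <= p.
    rewrite /X /e /q /= !finset.sub1set finset.in_set0.
    by case: (i \in Q) => /=; lra.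
  apply: (le_trans (ler_sum _ (fun i _ => Xk i))).
  rewrite sumr_const card_ord -[leLHS]mulr_natr /p divfK //.
  by rewrite gt_eqF.
- rewrite [leRHS](_ : _ = p * weight A Q).
    apply: le_trans (ler_wpM2l p0 hQ).
    rewrite le_eqVlt; apply/orP; left; apply/eqP.
    by rewrite /p; field; rewrite gt_eqF.
  rewrite mulr_sumr; apply: eq_bigr => i _; rewrite mulr_sumr; apply: eq_bigr => j _.
  rewrite /X /e /q /= !finset.sub1set !finset.in_set0 -mulnb natrM mul0r; ring.
Qed.

End sos4.

(** * Error of the test *)

(** The probability bound of [heavy_subset_prob] at level [t]. *)
Definition error_bound (R : realType) (n : nat) (t : R) : R :=
  8 * t / Num.sqrt n%:R + expR (1 / 2 - t / 4).

Lemma ler_weight (R : realType) (n : nat) (b b' : 'I_n -> 'I_n -> R) Q :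
  (forall i j : 'I_n, (i < j)%N -> b i j <= b' i j) -> weight b Q <= weight b' Q.
Proof.
move=> bb; apply: ler_sum => i _; apply: ler_sum => j ij.
by apply: ler_wpM2r; [exact: ler0n|exact: bb].
Qed.

Section test_error.
Context (R : realType) (n : nat) (cstar mu t : R) (k : nat).
Hypotheses (n0 : (0 < n)%N) (kn : (k <= n)%N) (t1 : 1 <= t).
Hypothesis kt : cstar * mu * k%:R <= t / 16.
Context d (T : measurableType d) (M : T -> 'M[R]_n).
Hypothesis mM : forall i j, measurable_fun setT (fun w => M w i j).

Let rejection : set T := [set w | sos4_test cstar mu k (M w) = false].

Lemma measurable_rejection : measurable rejection.
Proof.
rewrite (_ : rejection = ~` [set w | sos4_test cstar mu k (M w) = true]).
  exact/measurableC/measurable_sos4_test.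
apply/seteqP; split=> w; rewrite /rejection /=.
  by move=> ->.
by move/negP/negbTE.
Qed.

(** An arbitrary nonnegative mean [m] lets one statement serve both H_0 and the conditional law
    given the hidden set under H_1. *)
Lemma sos4_test_error (P : probability T R) (m : 'I_n -> 'I_n -> R) :
  (forall i j, 0 <= m i j) ->
  mutually_independent P (upper_pairs n) (fun e w => M w e.1 e.2) ->
  (forall i j : 'I_n, (i < j)%N ->
     has_law P (fun w => M w i j) (normal_prob (m i j) 1)) ->
  (P rejection <= (error_bound n t)%:E)%E.
Proof.
move=> m0 indM lawM.
have lawM' e : e \in upper_pairs n ->
    has_law P (fun w => M w e.1 e.2) (normal_prob (m e.1 e.2) 1).
  by case: e => i j; rewrite finset.inE => /lawM.
have [E [mE PE EQ]] := @heavy_subset_prob n d T R P (fun e w => M w e.1 e.2)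
  (fun e => m e.1 e.2) (fun e => mM e.1 e.2) indM lawM' t n0 t1.
apply: le_trans PE; apply: le_measure; rewrite ?inE //.
  exact: measurable_rejection.
move=> w; apply: contraPP => /EQ[Q hQ].
rewrite /rejection /= (sos4_test_of_weight (Q := Q)) //.
apply: le_trans (_ : t * n%:R / 16 <= _).
  by rewrite [leRHS]mulrAC; apply: ler_wpM2r.
apply: le_trans hQ _; apply: ler_weight => i j _.
by rewrite gerBl.
Qed.

(** The previous bound holds conditionally on each hidden set of size [k], uniformly in that set.
    Summing over the C(n, k) sets, each of mass 1 / C(n, k), removes the conditioning. *)
Lemma planted_test_error (P : probability T R) (Q : T -> {set 'I_n})
    (m : {set 'I_n} -> 'I_n -> 'I_n -> R) :
  (forall q i j, 0 <= m q i j) ->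
  (forall q, measurable (Q @^-1` [set q])) ->
  (forall q, P (Q @^-1` [set q]) =
     (if #|q| == k then ('C(n, k)%:R^-1)%:E else 0%E)) ->
  (forall q : {set 'I_n}, #|q| = k ->
     let Pq := cond_prob P (Q @^-1` [set q]) in
     mutually_independent Pq (upper_pairs n) (fun e w => M w e.1 e.2) /\
     forall i j : 'I_n, (i < j)%N ->
       has_law Pq (fun w => M w i j) (normal_prob (m q i j) 1)) ->
  (P rejection <= (error_bound n t)%:E)%E.
Proof.
move=> m0 mQ PQ condM; have mrej := measurable_rejection.
have e0 : 0 <= error_bound n t.
  by rewrite addr_ge0 ?expR_ge0 // divr_ge0 ?sqrtr_ge0 // mulr_ge0 // (le_trans _ t1).
have bin0 : 'C(n, k)%:R != 0 :> R by rewrite pnatr_eq0 -lt0n bin_gt0.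
have Pq q : (P (rejection `&` Q @^-1` [set q]) <=
    (error_bound n t)%:E * P (Q @^-1` [set q]))%E.
  rewrite PQ; case: ifPn => [/eqP qk|qk]; last first.
    rewrite mule0; apply: (@le_trans _ _ (P (Q @^-1` [set q]))).
      by apply: le_measure; rewrite ?inE //; exact: measurableI.
    by rewrite PQ (negbTE qk).
  pose mr : {measure set T -> \bar R} := mrestr P (mQ q).
  (* The conditional law as a genuine probability. The default [P] would be taken only for zero or
     infinite mass, whereas this event has mass 1 / C(n, k). *)
  pose P' : probability T R := mnormalize mr P.
  have P'E : P' = cond_prob P (Q @^-1` [set q]) :> (set T -> \bar R).
    have mrE U : mr U = P (U `&` Q @^-1` [set q]) by [].
    have mrT : mr setT = ('C(n, k)%:R^-1)%:E by rewrite mrE setTI PQ qk eqxx.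
    apply/funext => U; rewrite -[P' U]/(mnormalize mr P U) /mnormalize mrT /= orbF.
    rewrite eqe invr_eq0 (negbTE bin0) /cond_prob PQ qk eqxx mrE.
    by rewrite inver invr_eq0 (negbTE bin0).
  have := condM q qk; rewrite -P'E => -[indM lawM].
  have := sos4_test_error (m0 q) indM lawM.
  rewrite P'E /cond_prob PQ qk eqxx inver invr_eq0 (negbTE bin0) invrK.
  have Pfin : P (rejection `&` Q @^-1` [set q]) \is a fin_num.
    by apply: fin_num_measure; exact: measurableI.
  rewrite -(fineK Pfin) -!EFinM !lee_fin => h.
  by rewrite ler_pdivlMr // lt0r bin0 ler0n.
have rejE : rejection = \big[setU/set0]_(q <- index_enum {set 'I_n})
    (rejection `&` Q @^-1` [set q]).
  rewrite -bigcup_seq; apply/seteqP; split=> w; last by move=> [q _ []].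
  by move=> rw; exists (Q w) => //; rewrite /= mem_index_enum.
have subadd (r : seq {set 'I_n}) (F : {set 'I_n} -> set T) :
    (forall q, measurable (F q)) ->
    (P (\big[setU/set0]_(q <- r) F q) <= \sum_(q <- r) P (F q))%E.
  move=> mF; elim: r => [|q r IH]; first by rewrite !big_nil measure0.
  rewrite !big_cons; apply: le_trans (measureU2 _ _ _) _ => //.
    exact: bigsetU_measurable.
  exact: leeD2l.
rewrite rejE; apply: le_trans (subadd _ _ _) _.
  by move=> q; exact: measurableI.
apply: le_trans (lee_sum _ (fun q _ => Pq q)) _.
rewrite -ge0_sume_distrr; last by [].
under eq_bigr do rewrite PQ.
rewrite -big_mkcond /= sumEFin -EFinM lee_fin.
rewrite sumr_const (_ : #|_| = 'C(n, k)); last first.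
  rewrite -[in RHS](card_ord n) -card_draws; apply: eq_card => q.
  by rewrite !finset.inE.
by rewrite -[X in _ * X]mulr_natl divff // mulr1.
Qed.

End test_error.

(** * ** Asymptotics in n and conclusion *)

Section asymptotics.
Context (R : realType).

(** Since sqrt n = t sqrt t, the first term is exactly 8 / sqrt t. The inequality 1 + x <= exp x
    bounds the second by 2 * (4 / t), which is at most 8 / sqrt t. *)
Lemma error_bound_le (n : nat) (t : R) : 1 <= t -> n%:R = t ^+ 3 ->
  error_bound n t <= 16 / Num.sqrt t.
Proof.
move=> t1 nt; have t0 : 0 < t by lra.
pose s := Num.sqrt t; have s0 : 0 < s by rewrite sqrtr_gt0.
have ts : t = s ^+ 2 by rewrite sqr_sqrtr ?ltW.
have s1 : 1 <= s by rewrite -(@sqrtr1 R) ler_wsqrtr.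
have sn : Num.sqrt n%:R = t * s.
  by rewrite nt exprS sqrtrM ?sqrtr_sqr ?ltW // mulrC gtr0_norm.
have -> : error_bound n t = 8 / s + expR (1 / 2 - t / 4).
  by rewrite /error_bound sn; congr (_ + _); field; rewrite !gt_eqF.
have : expR (1 / 2 - t / 4) <= 8 / s; last by rewrite -/s; lra.
have e2 : expR (1 / 2) <= 2 :> R.
  have h : 2^-1 <= expR (- (1 / 2)) :> R.
    by apply: le_trans (expR_ge1Dx _); lra.
  by rewrite -[leLHS]invrK -expRN -[leRHS]invrK lef_pV2 ?posrE ?expR_gt0 ?invr_gt0.
have e4 : expR (- (t / 4)) <= 4 / t.
  rewrite expRN -[leRHS]invf_div lef_pV2 ?posrE ?expR_gt0 ?divr_gt0 //.
  by apply: le_trans (expR_ge1Dx _); lra.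
rewrite expRD; apply: le_trans (ler_pM (expR_ge0 _) (expR_ge0 _) e2 e4) _.
have -> : 2 * (4 / t) = 8 / t by field; rewrite gt_eqF.
by apply: ler_wpM2l => //; rewrite lef_pV2 ?posrE // ts expr2 ler_peMr // ltW.
Qed.

Lemma root3K (x : R) : 0 <= x -> (x `^ (3%:R^-1)) ^+ 3 = x.
Proof.
by move=> x0; rewrite -powR_mulrn ?powR_ge0 // -powRrM mulVf ?powRr1 // pnatr_eq0.
Qed.

Lemma cvg_root3 : (n%:R `^ (3%:R^-1) : R) @[n --> \oo] --> +oo.
Proof.
apply/cvgryPge => a; near=> n.
apply: le_trans (ler_norm a) _.
rewrite -(@ler_pXn2r _ 3) ?nnegrE ?powR_ge0 // root3K //.
by near: n; exact: nbhs_infty_ger.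
Unshelve. all: by end_near. Qed.

Lemma cvg_error_bound :
  16 / Num.sqrt (n%:R `^ (3%:R^-1) : R) @[n --> \oo] --> 0.
Proof.
rewrite -[X in _ --> X](mulr0 (16 : R)); apply: cvgM; first exact: cvg_cst.
apply/gtr0_cvgV0.
  near=> n; rewrite sqrtr_gt0 powR_gt0 // ltr0n.
  by near: n; exact: nbhs_infty_gt.
apply/cvgryPge => a; near=> n.
apply: le_trans (ler_norm a) _.
rewrite -[leLHS]sqrtr_sqr ler_wsqrtr //.
by near: n; move/cvgryPge: cvg_root3; exact.
Unshelve. all: by end_near. Qed.

End asymptotics.

Theorem theorem3 (R : realType) (cstar : R) (cstar_gt0 : 0 < cstar) :
  exists2 c : R, 0 < c &
  forall (mu : nat -> R) (k : nat -> nat)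
    (d0 : nat -> measure_display) (T0 : forall n, measurableType (d0 n))
    (P0 : forall n, probability (T0 n) R)
    (A0 : forall n, 'I_n -> 'I_n -> {RV (P0 n) >-> R})
    (d1 : nat -> measure_display) (T1 : forall n, measurableType (d1 n))
    (P1 : forall n, probability (T1 n) R)
    (Q : forall n, T1 n -> {set 'I_n})
    (A1 : forall n, 'I_n -> 'I_n -> {RV (P1 n) >-> R}),
  (forall n, (2 <= n)%N ->
     [/\ 0 < mu n,
         (1 <= k n <= n)%N
       & (k n)%:R <= c * (mu n)^-1 * (n%:R `^ (3%:R^-1)) / ln (n%:R)]) ->
  (forall n, (2 <= n)%N -> null_model (normal_prob 0 1) (A0 n)) ->
  (forall n, (2 <= n)%N ->
     planted_model (normal_prob 0 1) (normal_prob (mu n) 1) (k n)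
       (Q n) (A1 n)) ->
  let test := fun n => @sos4_test R cstar (mu n) (k n) n in
  [/\ P0 n [set w | test n (random_matrix (A0 n) w) = true]
        @[n --> \oo] --> (1 : \bar R)%E,
      P1 n [set w | test n (random_matrix (A1 n) w) = true]
        @[n --> \oo] --> (1 : \bar R)%E
    & ~ distinguishes A0 A1 test].
Proof.
(* As ln n >= ln 2 for n >= 2, this constant gives c_* mu k <= n^(1/3) / 16, which is the hypothesis
   [kt] of the error bounds at t = n^(1/3). *)
exists (ln 2 / (16 * cstar)); first by rewrite divr_gt0 ?ln_gt0 ?mulr_gt0 // ltr1n.
move=> mu k d0 T0 P0 A0 d1 T1 P1 Q A1 hk null planted test.
pose t n : R := n%:R `^ (3%:R^-1).
have t_ge1 n : (2 <= n)%N -> 1 <= t n.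
  move=> n2; rewrite -(@ler_pXn2r _ 3) ?nnegrE ?powR_ge0 //.
  by rewrite root3K // expr1n ler1n ltnW.
have kt n : (2 <= n)%N -> cstar * mu n * (k n)%:R <= t n / 16.
  move=> n2; have [mu0 _ kn] := hk n n2.
  have ln2 : 0 < ln 2 :> R by rewrite ln_gt0 // ltr1n.
  have lnn : ln 2 <= ln n%:R :> R.
    by rewrite ler_ln ?posrE ?ltr0n ?ler_nat // ltnW.
  have lnn0 : 0 < ln n%:R :> R by exact: lt_le_trans lnn.
  have cmu : 0 <= cstar * mu n by rewrite mulr_ge0 // ltW.
  apply: le_trans (ler_wpM2l cmu kn) _.
  rewrite -/(t n).
  have -> : cstar * mu n * (ln 2 / (16 * cstar) * (mu n)^-1 * t n / ln n%:R) =
    t n / 16 * (ln 2 / ln n%:R) by field; rewrite !gt_eqF.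
  apply: ler_piMr; last by rewrite ler_pdivrMr // mul1r.
  by rewrite divr_ge0 // powR_ge0.
have bound n : (2 <= n)%N -> error_bound n (t n) <= 16 / Num.sqrt (t n).
  by move=> n2; apply: error_bound_le; [exact: t_ge1|rewrite root3K].
have cvg1 d (T : forall n, measurableType (d n))
    (P : forall n, probability (T n) R)
    (A : forall n, 'I_n -> 'I_n -> {RV (P n) >-> R}) :
    (forall n, (2 <= n)%N ->
      P n [set w | test n (random_matrix (A n) w) = false] <=
        (error_bound n (t n))%:E)%E ->
    P n [set w | test n (random_matrix (A n) w) = true]
        @[n --> \oo] --> (1 : \bar R)%E.
  move=> err.
  apply: (@squeeze_cvge _ _ _ _ (fun n => (1 - 16 / Num.sqrt (t n))%:E) _ (fun=> 1%E)).
  - near=> n; have n2 : (2 <= n)%N by near: n; exact: nbhs_infty_ge.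
    have mA i j : measurable_fun setT (fun w => random_matrix (A n) w i j).
      rewrite (_ : (fun w => _) = A n i j) //.
      by apply/funext => w; rewrite mxE.
    have mt : measurable [set w | test n (random_matrix (A n) w) = true].
      exact: measurable_sos4_test.
    rewrite probability_le1 // andbT.
    have := probability_setC (P n) mt.
    have -> : ~` [set w | test n (random_matrix (A n) w) = true] =
        [set w | test n (random_matrix (A n) w) = false].
      by apply/seteqP; split=> w /=; [move/negP/negbTE|move=> ->].
    have := le_trans (err n n2) (_ : _ <= (16 / Num.sqrt (t n))%:E)%E.
    rewrite lee_fin => /(_ (bound n n2)) h1 h2; move: h1; rewrite h2.
    have Pfin : P n [set w | test n (random_matrix (A n) w) = true] \is a fin_num.
      exact: fin_num_measure.
    by rewrite -(fineK Pfin) -EFinB !lee_fin; lra.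
  - apply: cvg_EFin; first by apply: nearW.
    rewrite -[X in _ --> X](subr0 (1 : R)); apply: cvgB; first exact: cvg_cst.
    exact: cvg_error_bound.
  - exact: cvg_cst.
have H0 : P0 n [set w | test n (random_matrix (A0 n) w) = true]
    @[n --> \oo] --> (1 : \bar R)%E.
  apply: cvg1 => n n2; have [_ ind law] := null n n2.
  have [_ /andP[_ kn] _] := hk n n2.
  apply: (sos4_test_error (ltnW n2) kn (t_ge1 n n2) (kt n n2) _
    (m := fun _ _ => 0)) => //.
  - move=> i j; rewrite (_ : (fun w => _) = A0 n i j) //.
    by apply/funext => w; rewrite mxE.
  - rewrite (_ : (fun _ _ => _) = (fun p => A0 n p.1 p.2)) //.
    by apply/funext => p; apply/funext => w; rewrite mxE.
  - move=> i j ij; rewrite (_ : (fun w => _) = A0 n i j); first exact: law.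
    by apply/funext => w; rewrite mxE.
have H1 : P1 n [set w | test n (random_matrix (A1 n) w) = true]
    @[n --> \oo] --> (1 : \bar R)%E.
  apply: cvg1 => n n2; have [_ mQ PQ cond] := planted n n2.
  have [mu0 /andP[_ kn] _] := hk n n2.
  apply: (planted_test_error (ltnW n2) kn (t_ge1 n n2) (kt n n2) _ (Q := Q n)
    (* The conditional mean of the entries given the hidden set [q]. *)
    (m := fun q i j => if (i \in q) && (j \in q) then mu n else 0)) => //.
  - move=> i j; rewrite (_ : (fun w => _) = A1 n i j) //.
    by apply/funext => w; rewrite mxE.
  - by move=> q i j; case: ifP => // _; exact: ltW.
  - move=> q qk /=; have [ind law] := cond q qk; split.
      rewrite (_ : (fun _ _ => _) = (fun p => A1 n p.1 p.2)) //.
      by apply/funext => p; apply/funext => w; rewrite mxE.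
    move=> i j ij; rewrite (_ : (fun w => _) = A1 n i j).
      by have := law i j ij; case: ifP.
    by apply/funext => w; rewrite mxE.
split=> // dist.
(* The sum of the two errors dominates the type I error, which tends to 1, so it cannot vanish. *)
have : (1 <= 0 :> \bar R)%E.
  apply: (lee_cvg_to H0 dist); apply: nearW => n.
  by rewrite leeDl.
by rewrite lee_fin ler10.
Unshelve. all: by end_near.
Qed.
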